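(* There is an $\mathcal{O}(n)$ time algorithm that, given an idempotent permutation $\pi\in IP(n)$ with characteristic function defined implicitly (fixed elements negative, idle elements positive), in-place inverts the negative elements while permuting the positive elements, using $3\log n$ bits of additional space.
   Context: $[n]=\{1,\ldots,n\}$. An idempotent permutation of degree $k$ ($1\le k\le n$) is a permutation $\pi$ of $[n]$ together with a distinguished set of indices $A=\{a_1<\cdots<a_k\}\subseteq[n]$ such that the values $c_i=\pi(a_i)$ satisfy $1=c_1<c_2<\cdots<c_k$. The values $c_i$ are called the fixed elements of $\pi$ (this does not mean $\pi(c_i)=c_i$), the others idle. $IP(n)$ denotes the set of idempotent permutations of all degrees. The characteristic function of $A$ is ''defined implicitly'' when $\pi$ is stored in an array with fixed elements negated: the entry at $x$ is $-\pi(x)$ if $x\in A$ and $\pi(x)$ otherwise. ''In-place inverting the negative elements while permuting the positive elements'' (associative permuting) means transforming this array, in the same memory, into the sequence $\gamma$ in which every positive element $v$ has been moved to position $v$, and every negative element $-c_i$ at position $a_i$ has been moved to position $c_i$ and replaced by the negative $-a_i$ of its former position; i.e. $\gamma(c_i)=-a_i$ for $i=1,\ldots,k$ and $\gamma(x)=x$ for $x\in[n]\setminus\{c_1,\ldots,c_k\}$. Computation is on a unit-cost random access machine; ''$3\log n$ bits'' means that besides the array 3 auxiliary variables of $\log n$ bits each (indices or values of magnitude $O(n)$) are used. *)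

(* Defs.v *)
From mathcomp Require Import all_boot all_order all_algebra perm.

Set Implicit Arguments.
Unset Strict Implicit.
Unset Printing Implicit Defensive.

Import GRing.Theory.

Local Open Scope nat_scope.

(* The set [n] = {1, ..., n} is represented by 'I_n: the ordinal i stands for
   the element i.+1. *)

(* The list c_1, ..., c_k of the values pi(a_i), where a_1 < ... < a_k are the
   elements of A; enum lists the elements of a set of ordinals in increasing
   order. *)
Definition fixed_elements (n : nat) (pi : 'S_n) (A : {set 'I_n}) : seq nat :=
  [seq (pi a).+1 | a <- enum A].

(* 1 = c_1 < c_2 < ... < c_k.  The default head 0 excludes the degree k = 0. *)
Definition IP (n : nat) : {set 'S_n * {set 'I_n}} :=
  [set p | (head 0 (fixed_elements p.1 p.2) == 1) &&
           sorted ltn (fixed_elements p.1 p.2)].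

Definition array (n : nat) := {ffun 'I_n -> int}.

Definition signed_array (n : nat) (p : 'S_n * {set 'I_n}) : array n :=
  [ffun x => if x \in p.2 then (- Posz (p.1 x).+1)%R else Posz (p.1 x).+1].

(* gamma(c_i) = - a_i, and gamma(x) = x when x is not one of the c_i. *)
Definition associatively_permuted (n : nat) (p : 'S_n * {set 'I_n})
    (gamma : array n) : Prop :=
  (forall a, a \in p.2 -> gamma (p.1 a) = (- Posz a.+1)%R) /\
  (forall x, x \notin p.1 @: p.2 -> gamma x = Posz x.+1).

(* A unit-cost random access machine with m registers, whose only other
   storage is an array of n cells with addresses 1, ..., n.  The length n
   belongs to the input and can be read but not written.  There is no other
   memory: an access outside 1, ..., n is a fault. *)

Inductive location (m : nat) :=
  | Reg of 'I_m
  | Cell of 'I_m.  (* the array cell whose address is in the register *)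

Inductive operand (m : nat) :=
  | Const of int
  | Length
  | Loc of location m.

Inductive instruction (m : nat) :=
  | Move of location m & operand m
  | Add of location m & operand m & operand m
  | Sub of location m & operand m & operand m
  | Jump of nat
  | JumpEq of operand m & operand m & nat
  | JumpLe of operand m & operand m & nat
  | Halt.

Arguments Const {m}.
Arguments Length {m}.
Arguments Jump {m}.
Arguments Halt {m}.

Definition program (m : nat) := seq (instruction m).

Record config (m n : nat) := Config {
  pc : nat;
  regs : {ffun 'I_m -> int};
  cells : array n
}.

Definition cell_at (n : nat) (v : int) : option 'I_n :=
  if v is Posz i.+1 then insub i else None.

Section Machine.

Variables m n : nat.
Implicit Types (c : config m n) (P : program m).

Definition read_location c (l : location m) : option int :=
  match l with
  | Reg r => Some (regs c r)
  | Cell r => omap (cells c) (cell_at n (regs c r))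
  end.

Definition read c (o : operand m) : option int :=
  match o with
  | Const z => Some z
  | Length => Some (Posz n)
  | Loc l => read_location c l
  end.

Definition write c (l : location m) (v : int) : option (config m n) :=
  match l with
  | Reg r =>
      Some (Config (pc c).+1
        [ffun s => if s == r then v else regs c s] (cells c))
  | Cell r =>
      omap (fun i => Config (pc c).+1 (regs c)
                       [ffun j => if j == i then v else cells c j])
           (cell_at n (regs c r))
  end.

Definition goto c (l : nat) : config m n := Config l (regs c) (cells c).

Definition binary c (f : int -> int -> option (config m n))
    (o1 o2 : operand m) : option (config m n) :=
  obind (fun u => obind (f u) (read c o2)) (read c o1).

Definition branch c (b : bool) (l : nat) : option (config m n) :=
  Some (goto c (if b then l else (pc c).+1)).

(* None if the machine has halted, if an address is invalid, or if pc points
   outside the program. *)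
Definition step P c : option (config m n) :=
  match onth P (pc c) with
  | Some (Move l o) => obind (write c l) (read c o)
  | Some (Add l o1 o2) => binary c (fun u v => write c l (u + v)%R) o1 o2
  | Some (Sub l o1 o2) => binary c (fun u v => write c l (u - v)%R) o1 o2
  | Some (Jump l) => Some (goto c l)
  | Some (JumpEq o1 o2 l) => binary c (fun u v => branch c (u == v) l) o1 o2
  | Some (JumpLe o1 o2 l) => binary c (fun u v => branch c (u <= v)%R l) o1 o2
  | Some Halt | None => None
  end.

Definition run P (t : nat) c : option (config m n) :=
  iter t (obind (step P)) (Some c).

Definition halted P c : Prop := onth P (pc c) = Some Halt.

Definition start (a : array n) : config m n := Config 0 [ffun=> 0%R] a.

(* P transforms the array a into b in at most T steps.  In every configuration
   reached, the registers have magnitude at most S, and the cells have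
   magnitude at most n: no additional bits can be hidden in the array by
   enlarging its entries. *)
Definition transforms_within P (T S : nat) (a b : array n) : Prop :=
  (exists2 t, t <= T &
     exists c, [/\ run P t (start a) = Some c, halted P c & cells c = b]) /\
  (forall t c, run P t (start a) = Some c ->
     (forall r, absz (regs c r) <= S) /\ (forall i, absz (cells c i) <= n)).

End Machine.

(* Main.v *)
(* As pi is increasing on A, it matches the i-th element of A with the i-th
   element of C = pi(A), so the result depends on the sets A and C only and the
   idle values may be erased; no cycle of pi is followed.  A cell can encode
   membership of its index in both sets: 0 for neither, 1 for C only, -c for A
   only and c >= 2 for both, where c is the value stored there.  This is
   ambiguous only at a_1, where c = 1, and a_1 is kept in a register.

   A merge then runs a pointer a through A and a pointer q through C.  A cell
   y <= q already contains its final entry, negated when y > a is an element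
   of A still to be visited.  Decoding is possible because a final entry -a' at
   such a cell has a' <= a < y, so that -a', a', -y and y are distinct. *)

Require Import Defs.
From mathcomp Require Import all_boot all_order all_algebra perm.
From mathcomp Require Import zify.

Set Implicit Arguments.
Unset Strict Implicit.
Unset Printing Implicit Defensive.

Local Open Scope nat_scope.

(** * Backward verification of time and space bounds *)

Section Good.

Variables (m n : nat) (P : program m) (S : nat) (b : array n).

Definition bounded (c : config m n) : Prop :=
  (forall r, absz (regs c r) <= S) /\ (forall i, absz (cells c i) <= n).

(* The target array b is fixed and T bounds the remaining time, so that loops
   are verified backwards, from their exit. *)
Inductive good : nat -> config m n -> Prop :=
| GoodHalt T c : bounded c -> halted P c -> cells c = b -> good T c
| GoodStep T c c' : bounded c -> step P c = Some c' -> good T c' ->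
    good T.+1 c.

Lemma goodW T T' c : good T c -> T <= T' -> good T' c.
Proof.
move=> gTc; elim: gTc T' => {T c} [T c bc hc cb T' _|T c c' bc sc _ IH [//|T']].
  exact: GoodHalt.
by rewrite ltnS => /IH; apply: GoodStep.
Qed.

Lemma obind_iter_None t : iter t (obind (step (n := n) P)) None = None.
Proof. by elim: t => //= t ->. Qed.

(** The machine is deterministic and a halted configuration has no successor, so every reachable
    configuration lies on the derivation and carries its bound. *)
Lemma good_transforms T a : good T (start m a) -> transforms_within P T S a b.
Proof.
rewrite /transforms_within; move: (start m a) => c gTc.
elim: gTc => {T c} [T c bc hc cb|T c c' bc sc _ [[t tT [d [rd hd db]]] bnd]].
  split; first by exists 0 => //; exists c.
  move=> [|t] d; rewrite /run; first by case=> <-.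
  by rewrite iterSr /= /step hc obind_iter_None.
split.
  by exists t.+1 => //; exists d; split=> //; rewrite /run iterSr /= sc.
move=> [|s] e; rewrite /run; first by case=> <-.
by rewrite iterSr /= sc; apply: bnd.
Qed.

End Good.

(** * Registers and program *)

Definition R0 : 'I_3 := @Ordinal 3 0 isT.
Definition R1 : 'I_3 := @Ordinal 3 1 isT.
Definition R2 : 'I_3 := @Ordinal 3 2 isT.

Notation reg r := (Loc (Reg r)).
Notation cell r := (Loc (Cell r)).

(* 0-7 erase the idle values and leave a_1 in R2; 8-20 mark the elements of C;
   22-33 advance q = R0 and 34-46 advance a = R2. *)
Definition prog : program 3 := [::
  (* 0 *) Move (Reg R0) Length;
  (* 1 *) JumpEq (reg R0) (Const 0%R) 8;
  (* 2 *) JumpLe (cell R0) (Const 0%R) 5;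
  (* 3 *) Move (Cell R0) (Const 0%R);
  (* 4 *) Jump 6;
  (* 5 *) Move (Reg R2) (reg R0);
  (* 6 *) Defs.Sub (Reg R0) (reg R0) (Const 1%R);
  (* 7 *) Jump 1;
  (* 8 *) Add (Reg R0) Length (Const 1%R);
  (* 9 *) Move (Reg R1) (Const 1%R);
  (* 10 *) JumpLe (Const 0%R) (cell R1) 13;
  (* 11 *) Defs.Sub (Cell R1) (Const 0%R) (cell R1);
  (* 12 *) Jump 14;
  (* 13 *) Move (Cell R1) (Const 1%R);
  (* 14 *) Defs.Sub (Reg R0) (reg R0) (Const 1%R);
  (* 15 *) JumpLe (reg R0) (reg R2) 21;
  (* 16 *) Move (Reg R1) (cell R0);
  (* 17 *) JumpLe (Const 2%R) (reg R1) 10;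
  (* 18 *) Defs.Sub (Reg R1) (Const 0%R) (reg R1);
  (* 19 *) JumpLe (Const 2%R) (reg R1) 10;
  (* 20 *) Jump 14;
  (* 21 *) Move (Reg R0) (Const 0%R);
  (* 22 *) JumpEq (reg R0) Length 47;
  (* 23 *) Add (Reg R0) (reg R0) (Const 1%R);
  (* 24 *) Move (Reg R1) (reg R0);
  (* 25 *) JumpLe (cell R0) (Const 0%R) 27;
  (* 26 *) Defs.Sub (Reg R1) (Const 0%R) (reg R2);
  (* 27 *) JumpLe (reg R0) (reg R2) 32;
  (* 28 *) JumpLe (cell R0) (Const (-1)%R) 30;
  (* 29 *) JumpLe (cell R0) (Const 1%R) 32;
  (* 30 *) Defs.Sub (Cell R0) (Const 0%R) (reg R1);
  (* 31 *) Jump 33;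
  (* 32 *) Move (Cell R0) (reg R1);
  (* 33 *) JumpLe (Const 0%R) (reg R1) 22;
  (* 34 *) Add (Reg R2) (reg R2) (Const 1%R);
  (* 35 *) JumpLe (reg R2) Length 37;
  (* 36 *) Jump 22;
  (* 37 *) JumpLe (reg R2) (reg R0) 41;
  (* 38 *) JumpLe (cell R2) (Const (-1)%R) 22;
  (* 39 *) JumpLe (cell R2) (Const 1%R) 34;
  (* 40 *) Jump 22;
  (* 41 *) Add (Reg R1) (cell R2) (reg R2);
  (* 42 *) JumpEq (reg R1) (Const 0%R) 45;
  (* 43 *) JumpLe (cell R2) (Const 0%R) 34;
  (* 44 *) JumpEq (cell R2) (reg R2) 34;
  (* 45 *) Defs.Sub (Cell R2) (Const 0%R) (cell R2);
  (* 46 *) Jump 22;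
  (* 47 *) Halt].

(** * Verification rules for single instructions *)

Section Rules.

Variables (n : nat) (b : array n).

(** Arrays are given by formulas in the address, so that loop invariants are plain functions on
    [nat]. *)
Definition table (f : nat -> int) : array n := [ffun i => f (val i).+1].

Lemma eq_table f g : (forall y, 0 < y <= n -> f y = g y) -> table f = table g.
Proof. by move=> fg; apply/ffunP=> i; rewrite !ffunE fg //=. Qed.

Definition update (f : nat -> int) y v z : int := if z == y then v else f z.

Definition regs3 (x t a : int) : {ffun 'I_3 -> int} :=
  [ffun r => nth 0%R [:: x; t; a] (val r)].

Definition state k x t a f : config 3 n := Config k (regs3 x t a) (table f).

Lemma cell_atE y : 0 < y <= n ->
  exists2 i : 'I_n, cell_at n y = Some i & (val i).+1 = y.
Proof.
case: y => // y /= ltyn; exists (Ordinal ltyn) => //.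
by rewrite insubT.
Qed.

Definition get (r : 'I_3) x t a : int := nth 0%R [:: x; t; a] (val r).
Definition put (r : 'I_3) v k x t a f :=
  match val r with
  | 0 => state k v t a f
  | 1 => state k x v a f
  | _ => state k x t v f
  end.

Lemma read_reg k x t a f r :
  read (state k x t a f) (reg r) = Some (get r x t a).
Proof. by rewrite /= ffunE. Qed.

Lemma read_cell k x t a f r y : get r x t a = Posz y -> 0 < y <= n ->
  read (state k x t a f) (cell r) = Some (f y).
Proof.
move=> ry /cell_atE[i iE yE]; rewrite /= ffunE -/(get r x t a) ry iE /=.
by rewrite ffunE yE.
Qed.

Lemma write_reg k x t a f r v :
  write (state k x t a f) (Reg r) v = Some (put r v k.+1 x t a f).
Proof.
rewrite /write /put /state /=.
by case: r => [[|[|[|r]]] //= lt3]; congr (Some (Config _ _ _));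
   apply/ffunP=> -[[|[|[|s]]] //= ?]; rewrite !ffunE.
Qed.

Lemma write_cell k x t a f r y v : get r x t a = Posz y -> 0 < y <= n ->
  write (state k x t a f) (Cell r) v = Some (state k.+1 x t a (update f y v)).
Proof.
move=> ry /cell_atE[i iE yE]; rewrite /= ffunE -/(get r x t a) ry iE /=.
rewrite /state; congr (Some (Config _ _ _)); apply/ffunP=> j.
by rewrite !ffunE /update -yE eqSS.
Qed.

Definition table_bounded (f : nat -> int) :=
  forall y, 0 < y <= n -> absz (f y) <= n.

Definition state_bounded (x t a : int) f : Prop :=
  [/\ absz x <= 4 * n, absz t <= 4 * n & absz a <= 4 * n] /\ table_bounded f.

Lemma bounded_state k x t a f : 
  state_bounded x t a f -> bounded (4 * n) (state k x t a f).
Proof.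
move=> [[xb tb ab] fbf]; split=> [r|i] /=; rewrite ffunE.
  by case: r => [[|[|[|r]]]].
by apply: fbf; apply: ltn_ord.
Qed.

Notation good := (@good 3 n prog (4 * n) b).

Lemma table_bounded_update f y v :
  table_bounded f -> absz v <= n -> table_bounded (update f y v).
Proof.
by move=> fbf vn z zn; rewrite /update; case: eqP => // _; apply: fbf.
Qed.

Lemma read_R0 k x t a f : read (state k x t a f) (reg R0) = Some x.
Proof. exact: read_reg. Qed.

Lemma read_R1 k x t a f : read (state k x t a f) (reg R1) = Some t.
Proof. exact: read_reg. Qed.

Lemma read_R2 k x t a f : read (state k x t a f) (reg R2) = Some a.
Proof. exact: read_reg. Qed.

Lemma good_ext T k x t a f g : (forall y, 0 < y <= n -> f y = g y) ->
  good T (state k x t a g) -> good T (state k x t a f).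
Proof. by move=> fg; rewrite /state (eq_table fg). Qed.

Section Instr.
Variables (T k : nat) (x t a : int) (f : nat -> int).
Local Notation c := (state k x t a f).

Lemma good_jump l : state_bounded x t a f -> onth prog k = Some (Jump l) ->
  good T (state l x t a f) -> good T.+1 c.
Proof.
move=> okf kE; apply: GoodStep; first exact: bounded_state.
by rewrite /step kE.
Qed.

Lemma good_jle o1 o2 l u v :
  state_bounded x t a f -> onth prog k = Some (JumpLe o1 o2 l) ->
  read c o1 = Some u -> read c o2 = Some v ->
  ((u <= v)%R -> good T (state l x t a f)) ->
  ((v < u)%R -> good T (state k.+1 x t a f)) -> good T.+1 c.
Proof.
move=> okf kE r1 r2 g1 g2.
apply: (@GoodStep _ _ _ _ _ _ _ (goto c (if (u <= v)%R then l else k.+1))).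
- exact: bounded_state.
- by rewrite /step kE /binary r1 /= r2.
by case: ifP => uv; [apply: g1 | apply: g2; lia].
Qed.

Lemma good_jeq o1 o2 l u v :
  state_bounded x t a f -> onth prog k = Some (JumpEq o1 o2 l) ->
  read c o1 = Some u -> read c o2 = Some v ->
  (u = v -> good T (state l x t a f)) ->
  (u <> v -> good T (state k.+1 x t a f)) -> good T.+1 c.
Proof.
move=> okf kE r1 r2 g1 g2.
apply: (@GoodStep _ _ _ _ _ _ _ (goto c (if u == v then l else k.+1))).
- exact: bounded_state.
- by rewrite /step kE /binary r1 /= r2.
by case: eqP => uv; [apply: g1 | apply: g2].
Qed.

(** Groups the three writing instructions, so that one rule per kind of destination suffices. *)
Inductive computes (l : location 3) (v : int) : Prop :=
| CMove o u : onth prog k = Some (Move l o) -> read c o = Some u -> v = u ->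
    computes l v
| CAdd o1 o2 u1 u2 : onth prog k = Some (Add l o1 o2) ->
    read c o1 = Some u1 -> read c o2 = Some u2 -> v = (u1 + u2)%R ->
    computes l v
| CSub o1 o2 u1 u2 : onth prog k = Some (Defs.Sub l o1 o2) ->
    read c o1 = Some u1 -> read c o2 = Some u2 -> v = (u1 - u2)%R ->
    computes l v.

Lemma computes_step l v : computes l v -> step prog c = write c l v.
Proof.
rewrite /step.
case=> [o u -> /= -> -> //|o1 o2 u1 u2 -> r1 r2 ->|o1 o2 u1 u2 -> r1 r2 ->];
  by rewrite /binary r1 /= r2.
Qed.

Lemma good_wreg r v : state_bounded x t a f -> computes (Reg r) v ->
  good T (put r v k.+1 x t a f) -> good T.+1 c.
Proof.
move=> okf /computes_step sE; apply: GoodStep; first exact: bounded_state.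
by rewrite sE write_reg.
Qed.

Lemma good_wcell r y v :
  state_bounded x t a f -> computes (Cell r) v -> get r x t a = Posz y ->
  0 < y <= n -> good T (state k.+1 x t a (update f y v)) -> good T.+1 c.
Proof.
move=> okf /computes_step sE ry yn; apply: GoodStep; first exact: bounded_state.
by rewrite sE (@write_cell k x t a f r y v).
Qed.

End Instr.
End Rules.

Ltac bnd := split;
  [split; lia | repeat (apply: table_bounded_update; [|lia]); assumption].
Ltac rd := first [ apply: read_R0 | apply: read_R1 | apply: read_R2
  | eapply read_cell; [reflexivity | lia] | reflexivity ].
Ltac cmp := first
  [ eapply CMove; [reflexivity | rd | first [reflexivity | lia]]
  | eapply CAdd; [reflexivity | rd | rd | first [reflexivity | lia]]
  | eapply CSub; [reflexivity | rd | rd | first [reflexivity | lia]] ].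
Ltac jmp := eapply good_jump; [bnd | reflexivity |].
Ltac jle := eapply good_jle; [bnd | reflexivity | rd | rd | |].
Ltac jeq := eapply good_jeq; [bnd | reflexivity | rd | rd | |].
Ltac wreg v := eapply (good_wreg (v := v)); [bnd | cmp | rewrite /put /=].
Ltac wcell y v := eapply (good_wcell (y := y) (v := v));
  [bnd | cmp | reflexivity | lia |].

Lemma pairwise_total (T : eqType) (r : rel T) s x y :
  pairwise r s -> x \in s -> y \in s -> [|| x == y, r x y | r y x].
Proof.
elim: s => //= z s IH /andP[/allP rz ps]; rewrite !inE.
case/predU1P => [->|xs] /predU1P[->|ys]; rewrite ?eqxx //.
- by rewrite rz // orbT.
- by rewrite rz // !orbT.
- exact: IH.
Qed.

Section Extend.

Variables (n : nat) (T : Type) (d : T) (h : 'I_n -> T).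

Definition extend (y : nat) : T :=
  if y is z.+1 then oapp h d (insub z) else d.

Lemma extendE (i : 'I_n) : extend i.+1 = h i.
Proof. by rewrite /extend valK. Qed.

End Extend.

Lemma ord_of_index n y : 0 < y <= n -> exists i : 'I_n, y = i.+1.
Proof. by case: y => // y /= ltyn; exists (Ordinal ltyn). Qed.

(** * The sets A and C and their encoding in the array *)

Section Algorithm.

Variables (n : nat) (p : 'S_n * {set 'I_n}).
Hypothesis pIP : p \in IP n.

(* Indices are shifted to 1, ..., n; outside this range pv and pinv are 0. *)
Definition pv (y : nat) := extend 0 (fun i : 'I_n => (p.1 i).+1) y.
Definition pinv (y : nat) := extend 0 (fun i : 'I_n => (p.1^-1%g i).+1) y.
Definition inA (y : nat) := extend false (fun i : 'I_n => i \in p.2) y.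
Arguments pv : simpl never.
Arguments pinv : simpl never.
Arguments inA : simpl never.

Definition inC y := inA (pinv y).

Lemma pv_bound y : 0 < y <= n -> 0 < pv y <= n.
Proof. by move=> /ord_of_index[i ->]; rewrite /pv extendE /=. Qed.

Lemma pinv_bound y : 0 < y <= n -> 0 < pinv y <= n.
Proof. by move=> /ord_of_index[i ->]; rewrite /pinv extendE /=. Qed.

Lemma pvK y : 0 < y <= n -> pinv (pv y) = y.
Proof. by move=> /ord_of_index[i ->]; rewrite /pinv /pv !extendE permK. Qed.

Lemma pinvK y : 0 < y <= n -> pv (pinv y) = y.
Proof. by move=> /ord_of_index[i ->]; rewrite /pinv /pv !extendE permKV. Qed.

Lemma inA_bound y : inA y -> 0 < y <= n.
Proof. by rewrite /inA /extend; case: y => // y; case: insubP. Qed.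

(** [enum p.2] is increasing and, by the definition of [IP], so is the list of its images; hence two
    distinct entries are ordered alike before and after the permutation. *)
Lemma pv_mono x y : inA x -> inA y -> x < y -> pv x < pv y.
Proof.
move=> Ax Ay; have [i iE] := ord_of_index (inA_bound Ax).
have [j jE] := ord_of_index (inA_bound Ay); move: Ax Ay.
rewrite {}iE {}jE /inA /pv !extendE !ltnS => Ai Aj ltij.
move: pIP; rewrite inE => /andP[_].
rewrite /fixed_elements sorted_pairwise; last exact: ltn_trans.
rewrite pairwise_map => pw1.
have: pairwise (relpre val ltn) (enum p.2).
  rewrite -pairwise_map -sorted_pairwise; last exact: ltn_trans.
  apply: (subseq_sorted ltn_trans (s2 := map val (enum 'I_n))).
    by apply: map_subseq; rewrite [enum 'I_n]enumT; apply: filter_subseq.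
  by rewrite val_enum_ord iota_ltn_sorted.
move=> pw2.
have := @pairwise_total _ [rel u v : 'I_n | (u < v) && (p.1 u < p.1 v)]
  (enum p.2) i j.
rewrite pairwise_relI [pairwise _ _]pw2 /=.
have -> : pairwise (fun u v : 'I_n => p.1 u < p.1 v) (enum p.2).
  exact: sub_pairwise pw1.
rewrite !mem_enum => /(_ isT Ai Aj) /or3P[/eqP ijE|/andP[] //|/andP[ltji _]].
  by rewrite ijE ltnn in ltij.
by rewrite ltnNge (ltnW ltji) in ltij.
Qed.

Lemma inA_pinv1 : inA (pinv 1).
Proof.
have [a Aa pa0]: exists2 a, a \in p.2 & p.1 a = 0 :> nat.
  move: pIP; rewrite inE /fixed_elements => /andP[+ _].
  (* If A were empty, the default head [0] would contradict the head condition. *)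
  case: (enum p.2) (mem_enum (mem p.2)) => //= a s /(_ a).
  by rewrite inE eqxx /= => Aa /eqP[pa0]; exists a.
have e1 : 1 = (p.1 a).+1 by rewrite pa0.
have -> : pinv 1 = a.+1 by rewrite [in LHS]e1 /pinv extendE permK.
by rewrite /inA extendE.
Qed.

Lemma n_gt0 : 0 < n.
Proof. by have := inA_bound inA_pinv1; lia. Qed.

Local Notation a1 := (pinv 1).

(** [M] is the part of C marked so far: [pred0] after the erasure, [inC] when the merge begins. *)
Definition code (M : pred nat) (y : nat) : int :=
  if inA y then if M y then Posz (pv y) else (- Posz (pv y))%R
  else Posz (M y : nat).

Definition final (y : nat) : int :=
  if inC y then (- Posz (pinv y))%R else Posz y.

Definition merged (a q y : nat) : int :=
  if y <= q then if (y <= a) || ~~ inA y then final y else (- final y)%R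
  else code inC y.

Local Notation good := (@good 3 n prog (4 * n) (table n final)).

Lemma pv1 : pv a1 = 1.
Proof. by apply: pinvK; have := n_gt0. Qed.

Lemma a1_min x : inA x -> a1 <= x.
Proof.
move=> Ax; rewrite leqNgt; apply/negP=> /(pv_mono Ax inA_pinv1).
by rewrite pv1; have := pv_bound (inA_bound Ax); lia.
Qed.

Lemma code_bound M : table_bounded n (code M).
Proof.
move=> y yn; have := pv_bound yn; rewrite /code.
by case: (inA y) => //; case: (M y) => /=; lia.
Qed.

Lemma code_gt0 M y : 0 < y <= n -> (0 < code M y)%R = M y.
Proof.
move=> yn; have := pv_bound yn; rewrite /code.
by case: (inA y) => //; case: (M y) => /=; lia.
Qed.

(** Beyond [a1] the fixed values are at least 2, so they cannot be mistaken for the marks 0 and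
    1. *)
Lemma code_inA M y : 0 < y <= n -> a1 < y ->
  inA y = (code M y < 0)%R || (1 < code M y)%R.
Proof.
move=> yn ay; rewrite /code; case: (boolP (inA y)) => Ay; last by case: (M y).
by have := pv_mono inA_pinv1 Ay ay; rewrite pv1; case: (M y) => /=; lia.
Qed.

Lemma final_bound y : 0 < y <= n -> absz (final y) <= n.
Proof. by move=> yn; have := pinv_bound yn; rewrite /final; case: inC; lia. Qed.

Lemma merged_bound a q : table_bounded n (merged a q).
Proof.
move=> y yn; rewrite /merged; case: ifP => _; last exact: (code_bound inC yn).
by have := final_bound yn; case: ifP => _; lia.
Qed.

(** * The merge of A and C *)

Lemma inC_pv x : inA x -> inC (pv x).
Proof. by move=> Ax; rewrite /inC pvK // inA_bound. Qed.

Lemma merged_update a q w :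
  w = (if (q.+1 <= a) || ~~ inA q.+1 then final q.+1 else (- final q.+1)%R) ->
  forall z, update (merged a q) q.+1 w z = merged a q.+1 z.
Proof.
move=> -> z; rewrite /update /merged; case: (ltngtP z q.+1) => [zq|zq|->] //.
by rewrite -ltnS zq.
by rewrite leqNgt (ltn_trans _ zq).
Qed.

(** The preimage of [q.+1] is not below [a], as its value exceeds [q]. Were it above [a],
    monotonicity would give [pv a <= q], hence [a < a]. *)
Lemma next_fixed a q : q < n -> a = n.+1 \/ inA a ->
  (forall x, inA x -> (pv x <= q) = (x < a)) -> inC q.+1 ->
  [/\ inA a, pinv q.+1 = a & pv a = q.+1].
Proof.
move=> qn Aa sync Cq; have Ax := Cq.
have pvx : pv (pinv q.+1) = q.+1 by apply: pinvK.
have xn := inA_bound Ax; have := sync _ Ax; rewrite pvx ltnn => /esym ax.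
case: Aa => [aE|Aa]; first by rewrite /inC in Cq; lia.
case: (ltngtP (pinv q.+1) a) ax => // [ax|<-] _; last by [].
by have := pv_mono Aa Ax ax; have := sync _ Aa; rewrite pvx; lia.
Qed.

(** At [q = n] the synchronization hypothesis places all of A below [a], so no negated entry is
    left. *)
Lemma merge_done (t : int) a : absz t <= 4 * n -> a1 <= a <= n.+1 ->
  (forall x, inA x -> (pv x <= n) = (x < a)) ->
  good 1 (state n 22 n t a (merged a n)).
Proof.
move=> tb an sync; have n0 := n_gt0; have fbf := merged_bound a n.
jeq => // _; apply: GoodHalt => //.
  apply: bounded_state; bnd.
apply: eq_table => y yn; have yn' : y <= n by lia.
rewrite /merged yn'.
case: (boolP (inA y)) => [Ay|]; last by rewrite orbT.
have -> // : y <= a.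
by have := sync y Ay; have := pv_bound yn; lia.
Qed.

(** A temporary sign depends on [a] only through whether the address of its cell has been visited,
    so one advance of [a] affects at most one cell. *)
Lemma mergedS a q y : merged a.+1 q y =
  if (y == a.+1) && (y <= q) && inA y then (- merged a q y)%R else merged a q y.
Proof.
rewrite /merged; case: (ltngtP y a.+1) => [ya|ya|->] /=.
- by have -> : y <= a by lia.
- by have -> : (y <= a) = false by lia.
- rewrite ltnn /=; case: (a.+1 <= q) => //=.
  by case: (inA a.+1) => //=; rewrite GRing.opprK.
Qed.

(* The two parts are the loops advancing q (entered at 22) and a (at 34). *)
Lemma merge_good m :
  (forall a q (t : int), n - q + (n.+1 - a) <= m -> absz t <= 4 * n ->
     a1 <= a <= n.+1 -> q <= n -> a = n.+1 \/ inA a ->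
     (forall x, inA x -> (pv x <= q) = (x < a)) ->
     good (20 * m + 1) (state n 22 q t a (merged a q))) /\
  (forall a q (t : int), n - q + (n.+1 - a) <= m -> absz t <= 4 * n ->
     a1 <= a <= n -> q <= n ->
     (forall x, inA x -> (pv x <= q) = (x <= a)) ->
     good (20 * m + 1) (state n 34 q t a (merged a q))).
Proof.
elim: m => [|m [IHC IHA]].
  (* Measure zero forces [a = n.+1] and [q = n]; the loop advancing [a] has [a <= n], so there it
     cannot occur. *)
  split=> a q t mq tb an; last by lia.
  have -> : a = n.+1 by lia.
  move=> qn; have -> : q = n by lia.
  by move=> _ sync; apply: merge_done => //; lia.
split=> a q t mq tb an qn.
- move=> Aa sync; have fbf := merged_bound a q; have n0 := n_gt0.
  have [qE|qn'] : q = n \/ q < n by lia.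
    apply: (@goodW _ _ _ _ _ 1); last by lia.
    by move: sync; rewrite qE => sync; apply: merge_done.
  (* A pass lowers the measure by one and takes fewer than 20 steps; the extra 1 pays for the exit
     test. *)
  apply: (@goodW _ _ _ _ _ (20 + (20 * m + 1))); last by lia.
  jeq; first by lia.
  move=> _.
  have yn : 0 < q.+1 <= n by lia.
  have fy : merged a q q.+1 = code inC q.+1 by rewrite /merged ltnn.
  have vC := code_gt0 inC yn.
  have Ay : a < q.+1 ->
      inA q.+1 = (code inC q.+1 < 0)%R || (1 < code inC q.+1)%R.
    by move=> ay; apply: code_inA => //; lia.
  wreg (Posz q.+1). wreg (Posz q.+1).
  (* The content of [R1]. For [q.+1] in C it is the final entry because the preimage of [q.+1] is
     the current [a]. *)
  pose v : int := if inC q.+1 then (- Posz a)%R else q.+1.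
  have vE : v = final q.+1.
    rewrite /v /final; case: ifP => // Cq.
    by have [_ -> _] := next_fixed qn' Aa sync Cq.
  have vb := final_bound yn; rewrite -vE in vb.
  have a1n := inA_bound inA_pinv1.
  (* [G33], like [G32], [G30] and [G27], treats the run from the instruction of that number, where
     branches join. The sign of [v] selects the next loop. *)
  have G33 : good (3 + (20 * m + 1)) (state n 33 q.+1 v a (merged a q.+1)).
    have fbf' := merged_bound a q.+1.
    jle.
      rewrite /v; case: ifP => Cq; first by lia.
      move=> _; apply: goodW; first apply: IHC => //; try lia.
      move=> x Ax; rewrite -sync //; have := inC_pv Ax.
      by case: (ltngtP (pv x) q.+1) => [?|?|->] //; lia.
    rewrite {1}/v; case: ifP => Cq; last by lia.
    have [Aa' _ paE] := next_fixed qn' Aa sync Cq => _.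
    have an' := inA_bound Aa'.
    apply: goodW; first apply: IHA => //; try lia.
    move=> x Ax; case: (ltngtP x a) => [xa|xa|->]; last by rewrite paE ltnSn.
      by have := sync x Ax; lia.
    by have := pv_mono Aa' Ax xa; lia.
  have G27 : good (9 + (20 * m + 1)) (state n 27 q.+1 v a (merged a q)).
    have G32 : (q.+1 <= a) || ~~ inA q.+1 ->
        good (4 + (20 * m + 1)) (state n 32 q.+1 v a (merged a q)).
      move=> qA; wcell q.+1 v.
      apply: good_ext G33 => z _; apply: merged_update.
      by rewrite qA.
    jle => qa.
      by apply: goodW; first apply: G32; lia.
    have G30 : inA q.+1 ->
        good (5 + (20 * m + 1)) (state n 30 q.+1 v a (merged a q)).
      move=> qA; wcell q.+1 (- v)%R; jmp.
      apply: good_ext G33 => z _; apply: merged_update.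
      by rewrite qA vE leqNgt ifF //; lia.
    jle; rewrite fy => c1.
      by apply: goodW; first apply: G30; lia.
    jle; rewrite fy => c2.
      by apply: goodW; first apply: G32; lia.
    by apply: goodW; first apply: G30; lia.
  jle; rewrite fy => cy.
    move: G27; rewrite /v ifF => [G27|]; last by lia.
    by apply: goodW; first apply: G27; lia.
  wreg (-(Posz a))%R.
  move: G27; rewrite /v ifT => [G27|]; last by lia.
  by apply: goodW; first apply: G27; lia.
- move=> sync; have fbf := merged_bound a q; have n0 := n_gt0.
  have a1n := inA_bound inA_pinv1.
  apply: (@goodW _ _ _ _ _ (20 + (20 * m + 1))); last by lia.
  wreg (Posz a.+1).
  have GC (t' : int) : absz t' <= 4 * n -> a.+1 = n.+1 \/ inA a.+1 ->
      good (20 * m + 1) (state n 22 q t' a.+1 (merged a.+1 q)).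
    by move=> tb' Aa; apply: IHC => //; lia.
  have GA (t' : int) : absz t' <= 4 * n -> a < n -> ~~ inA a.+1 ->
      good (20 * m + 1) (state n 34 q t' a.+1 (merged a q)).
    move=> tb' an' nAa; apply: (@good_ext _ _ _ _ _ _ _ _ (merged a.+1 q)).
      by move=> y _; rewrite mergedS; case: eqP => //= ->;
        rewrite (negPf nAa) andbF.
    apply: IHA => //; try lia.
    move=> x Ax; rewrite sync //; case: (x =P a.+1) => [xa|]; last by lia.
    by move: nAa; rewrite -xa Ax.
  jle => an'; last first.
    jmp; apply: (@good_ext _ _ _ _ _ _ _ _ (merged a.+1 q)).
      by move=> y yn; rewrite mergedS; case: eqP => // ya; lia.
    by apply: goodW; first apply: GC => //; lia.
  have yn : 0 < a.+1 <= n by lia.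
  have fy : merged a q a.+1 = if a.+1 <= q then
      if inA a.+1 then (- final a.+1)%R else final a.+1 else code inC a.+1.
    by rewrite /merged ltnn /=; case: (inA a.+1).
  have vb := fbf _ yn.
  jle; last first => aq.
    (* Beyond [q] the cell still holds its code, which decides membership in A. *)
    have Ay : inA a.+1 = (merged a q a.+1 < 0)%R || (1 < merged a q a.+1)%R.
      by rewrite fy ifF; [apply: code_inA => // |]; lia.
    have GC' : inA a.+1 -> good (20 * m + 1) (state n 22 q t a.+1 (merged a q)).
      move=> Aa; apply: (@good_ext _ _ _ _ _ _ _ _ (merged a.+1 q)).
        move=> y _; rewrite mergedS; case: eqP => //= ->.
        by rewrite ifF //; lia.
      by apply: GC => //; right.
    jle => c1; first by apply: goodW; first apply: GC'; lia.
    jle => c2; first by apply: goodW; first apply: GA => //; lia.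
    jmp; by apply: goodW; first apply: GC'; lia.
  rewrite ifT in fy; last by lia.
  (* If [a.+1] is in C, its preimage is at most [a] by synchronization, since [a.+1 <= q]. *)
  have gy : final a.+1 = a.+1 \/
      (final a.+1 < 0)%R && (- (a.+1 : int) < final a.+1)%R.
    rewrite /final; case: ifP => Cy; last by left.
    right; have := sync _ Cy; have := inA_bound Cy; rewrite pinvK //; lia.
  wreg (merged a q a.+1 + a.+1)%R.
  have G45 (t' : int) : absz t' <= 4 * n -> inA a.+1 ->
      good (2 + (20 * m + 1)) (state n 45 q t' a.+1 (merged a q)).
    move=> tb' Aa; wcell a.+1 (- merged a q a.+1)%R; jmp.
    apply: (@good_ext _ _ _ _ _ _ _ _ (merged a.+1 q)).
      move=> y _; rewrite mergedS /update; case: eqP => //= ->.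
      by rewrite Aa ifT //; lia.
    by apply: GC => //; right.
  jeq => c0.
    have Aa : inA a.+1 by move: c0; rewrite fy; case: ifP => // _; lia.
    by apply: goodW; first apply: G45 => //; lia.
  jle => c1.
    have nAa : ~~ inA a.+1 by apply/negP=> Aa; move: c0 c1; rewrite fy Aa; lia.
    by apply: goodW; first apply: GA => //; lia.
  jeq => c2.
    have nAa : ~~ inA a.+1 by apply/negP=> Aa; move: c0 c2; rewrite fy Aa; lia.
    by apply: goodW; first apply: GA => //; lia.
  have Aa : inA a.+1 by move: c1 c2; rewrite fy; case: ifP => // _; lia.
  by apply: goodW; first apply: G45 => //; lia.
Qed.

(** * Marking the elements of C *)

(** An unmarked cell is negative if its address is in A and zero otherwise. Marking by negation
    keeps the magnitude, so the stored value can still be read later. *)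
Lemma mark_good T (x : int) M M' c : absz x <= 4 * n -> 0 < c <= n ->
  ~~ M c -> (forall y, 0 < y <= n -> M' y = M y || (y == c)) ->
  good T (state n 14 x c a1 (code M')) ->
  good (4 + T) (state n 10 x c a1 (code M)).
Proof.
move=> xb cn Mc MM' G14; have fbf := code_bound M; have cb := pv_bound cn.
have cb' := fbf c cn.
have a1n := inA_bound inA_pinv1.
have ext w : w = code M' c ->
    forall y, 0 < y <= n -> update (code M) c w y = code M' y.
  move=> -> y yn; rewrite /update; case: eqP => [-> //|/eqP yc].
  by rewrite /code MM' // (negPf yc) orbF.
have codec : code M c = if inA c then (- Posz (pv c))%R else 0%R.
  by rewrite /code (negPf Mc).
have codec' : code M' c = if inA c then Posz (pv c) else 1%R.
  by rewrite /code MM' // eqxx orbT.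
jle => cM.
  wcell c (Posz 1); apply: goodW; last exact: leqnSn.
  apply: goodW; first apply: good_ext G14; last by [].
  apply: ext; rewrite codec' ifF //.
  by move: cM; rewrite codec; case: ifP => //; lia.
wcell c (- code M c)%R; jmp.
apply: goodW; first apply: good_ext G14; last by [].
by apply: ext; move: cM; rewrite codec' codec; case: ifP; lia.
Qed.

(** The element 1 is marked before the scan, which descends from [n] and stops short of the
    ambiguous cell at [a1]. *)
Definition marked (x y : nat) : bool := inC y && ((y == 1) || (x <= pinv y)).

Lemma markedS x y : 0 < y <= n -> a1 < x ->
  marked x y = marked x.+1 y || inA x && (y == pv x).
Proof.
move=> yn ax; rewrite /marked; case: (boolP (inC y)) => [Cy|nCy] /=.
  rewrite leq_eqVlt orbCA orbC; congr (_ || _).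
  apply/eqP/andP => [->|[Ax /eqP->]]; last by rewrite pvK // inA_bound.
  by split=> //; rewrite pinvK.
by apply/esym/negP=> /andP[Ax /eqP yE]; rewrite yE inC_pv in nCy.
Qed.

Lemma marks_good x (t : int) : absz t <= 4 * n -> a1 < x <= n.+1 ->
  good (11 * x + (20 * (2 * n) + 4)) (state n 14 x t a1 (code (marked x))).
Proof.
have a1n := inA_bound inA_pinv1.
elim: x t => [|x IH] t tb; first by lia.
rewrite ltnS => xn; have fbf := code_bound (marked x.+1).
apply: (@goodW _ _ _ _ _ (11 + (11 * x + (20 * (2 * n) + 4)))); last by lia.
wreg (Posz x); jle => ax.
  wreg (Posz 0).
  apply: (@goodW _ _ _ _ _ (20 * (2 * n) + 1)); last by lia.
  (* At [q = 0] every cell holds its code, and all of C is marked because the scan has reached [a1],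
     the least element of A. *)
  apply: (@good_ext _ _ _ _ _ _ _ _ (merged a1 0)).
    move=> y yn; rewrite /merged ifF; last by lia.
    rewrite /code (_ : marked x.+1 y = inC y) // /marked.
    case: (boolP (inC y)) => //= Cy; case: eqP => //= y1.
    have -> : x = a1 by lia.
    have := a1_min Cy; case: ltngtP => // a1y.
    by case: y1; rewrite -(pinvK yn) -a1y pv1.
  have [+ _] := merge_good (2 * n); apply => //; try lia.
    by right; apply: inA_pinv1.
  move=> y Ay; have := a1_min Ay; have := pv_bound (inA_bound Ay); lia.
have xn' : 0 < x <= n by lia.
have ax' : a1 < x by lia.
have cb := fbf _ xn'; have Ax := code_inA (marked x.+1) xn' ax'.
have skip (t' : int) : absz t' <= 4 * n -> ~~ inA x ->
    good (11 * x + (20 * (2 * n) + 4))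
      (state n 14 x t' a1 (code (marked x.+1))).
  move=> tb' nAx; apply: good_ext (IH t' tb' _); last by lia.
  by move=> y yn; rewrite /code (markedS yn ax') (negPf nAx) orbF.
have mark : inA x -> good (4 + (11 * x + (20 * (2 * n) + 4)))
    (state n 10 x (pv x) a1 (code (marked x.+1))).
  move=> Ax'; have pvb := pv_bound xn'.
  apply: mark_good (IH _ _ _) => //; try lia.
    rewrite /marked pvK // ltnn orbF negb_and; apply/orP; right.
    by have := pv_mono inA_pinv1 Ax' ax'; rewrite pv1; lia.
  by move=> y yn; rewrite (markedS yn ax') Ax'.
(* The cell of [x] may itself be marked by now, so its value is tested with both signs. *)
wreg (code (marked x.+1) x); jle => c1.
  have Ax' : inA x by lia.
  have cE : code (marked x.+1) x = pv x.
    by move: c1; rewrite /code Ax'; case: ifP => //; lia.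
  by rewrite cE; apply: goodW; first apply: mark; lia.
wreg (- code (marked x.+1) x)%R; jle => c2.
  have Ax' : inA x by lia.
  have cE : (- code (marked x.+1) x)%R = pv x.
    by move: c2; rewrite /code Ax'; case: ifP => //; lia.
  by rewrite cE; apply: goodW; first apply: mark; lia.
have nAx : ~~ inA x.
  apply/negP=> Ax'; have := pv_mono inA_pinv1 Ax' ax'; rewrite pv1.
  by move: c1 c2; rewrite /code Ax'; case: ifP; lia.
by jmp; apply: goodW; first apply: skip => //; lia.
Qed.

(** * Erasing the idle values *)

Definition signed (y : nat) : int :=
  if inA y then (- Posz (pv y))%R else Posz (pv y).

Definition cleared (x y : nat) : int :=
  if x < y then code pred0 y else signed y.

Lemma cleared_bound x : table_bounded n (cleared x).
Proof.
move=> y yn; rewrite /cleared.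
case: ifP => _; first exact: (code_bound pred0 yn).
by have := pv_bound yn; rewrite /signed; case: ifP; lia.
Qed.

(** The scan descends, so the last index of A stored in [R2] is [a1]. The term [431 * n + 30]
    generously covers the marking and the merge. *)
Lemma clear_good x r : x <= n -> r <= n -> (x < a1 -> r = a1) ->
  good (8 * x + (431 * n + 30)) (state n 1 x 0%R r (cleared x)).
Proof.
have a1n := inA_bound inA_pinv1.
elim: x r => [|x IH] r xn rn ra1; have fbf := cleared_bound.
  have {ra1}-> : r = a1 by apply: ra1; lia.
  have {}fbf := fbf 0.
  (* 7 = 3 + 4: the exit test, two initializations, and the marking of 1. *)
  apply: (@goodW _ _ _ _ _ (7 + (11 * n.+1 + (20 * (2 * n) + 4)))); last by lia.
  jeq => // _; wreg (Posz n.+1); wreg (Posz 1).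
  apply: (@good_ext _ _ _ _ _ _ _ _ (code pred0)).
    by move=> y /andP[y0 _]; rewrite /cleared y0.
  apply: mark_good (marks_good _ _); rewrite ?pv1 //; try lia.
  (* No preimage exceeds [n], so [marked n.+1] holds of 1 only. *)
  move=> y yn; rewrite /marked /=; case: eqP => [->|_].
    by rewrite /inC inA_pinv1.
  by have := pinv_bound yn; case: (inC y) => //=; lia.
have {}fbf := fbf x.+1; have yn : 0 < x.+1 <= n by lia.
have pb := pv_bound yn.
apply: (@goodW _ _ _ _ _ (8 + (8 * x + (431 * n + 30)))); last by lia.
have fx : cleared x.+1 x.+1 = signed x.+1 by rewrite /cleared ltnn.
have ext w : w = code pred0 x.+1 ->
    forall y, update (cleared x.+1) x.+1 w y = cleared x y.
  move=> -> y; rewrite /update /cleared.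
  by case: (ltngtP y x.+1) => [_|_|->].
jeq => // _; jle; rewrite fx /signed => c0.
  have Ax : inA x.+1 by move: c0; case: ifP => //; lia.
  wreg (Posz x.+1); wreg (Posz x); jmp.
  apply: goodW; first apply: (@good_ext _ _ _ _ _ _ _ _ (cleared x)).
  - move=> y _; rewrite -(ext _ (erefl _)) /update; case: eqP => // ->.
    by rewrite fx /signed /code Ax.
  - apply: IH; [lia..|move=> xa].
    by apply/eqP; rewrite eqn_leq a1_min // andbT; lia.
  - lia.
have nAx : ~~ inA x.+1 by move: c0; case: ifP => //; lia.
wcell x.+1 (Posz 0); jmp; wreg (Posz x); jmp.
apply: goodW; first apply: (@good_ext _ _ _ _ _ _ _ _ (cleared x)).
- by move=> y _; apply: ext; rewrite /code (negPf nAx).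
- apply: IH; [lia..|move=> xa; apply: ra1].
  by rewrite ltn_neqAle xa andbT; apply: contraNneq nAx => ->; apply: inA_pinv1.
- lia.
Qed.

(** * Input, output and total bounds *)

Lemma signed_arrayE : signed_array p = table n signed.
Proof.
by apply/ffunP=> i; rewrite !ffunE /signed /inA /pv !extendE.
Qed.

Lemma start_good : good (500 * n) (start 3 (signed_array p)).
Proof.
have n0 := n_gt0; have fbf := cleared_bound n.
have -> : start 3 (signed_array p) = state n 0 0%R 0%R 0%R (cleared n).
  rewrite /start /state signed_arrayE; congr Config.
    by apply/ffunP=> -[[|[|[|r]]] //= ?]; rewrite !ffunE.
  by apply: eq_table => y yn; rewrite /cleared ifF //; lia.
(* The constant term is absorbed because [n] is positive, A being nonempty. *)
apply: (@goodW _ _ _ _ _ (1 + (8 * n + (431 * n + 30)))); last by lia.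
wreg (Posz n); apply: clear_good => //.
by have := inA_bound inA_pinv1; lia.
Qed.

Lemma final_associatively_permuted : associatively_permuted p (table n final).
Proof.
split=> [a Aa|x nCx]; rewrite ffunE /final /=.
  by rewrite ifT /inC /pinv extendE permK // /inA extendE.
rewrite ifF //; apply: contraNF nCx.
rewrite /inC /pinv extendE /inA extendE => Ax.
by apply/imsetP; exists (p.1^-1%g x); rewrite ?permKV.
Qed.

End Algorithm.

Theorem theorem3p22 :
  exists (P : program 3) (CT CS : nat),
    forall (n : nat) (p : 'S_n * {set 'I_n}), p \in IP n ->
      exists2 gamma : array n,
        transforms_within P (CT * n) (CS * n) (signed_array p) gamma &
        associatively_permuted p gamma.
Proof.
(* The largest register contents are [n.+1] and the sum of a cell and its address, at most [2 * n];
   the factor 4 leaves slack. *)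
exists prog, 500, 4 => n p pIP; exists (table n (final p)).
  exact/good_transforms/start_good.
exact: final_associatively_permuted.
Qed.
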